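(* Fix positive integers $T$ and $K$. Let $d_x=1$, $d_y=q=2TK$, $x_0=0\in\mathbb{R}$, $y_0=0\in\mathbb{R}^q$, and $$f(x,y)=2(x+1)^2\sum_{j=q/2+1}^{q}\psi(y_{[j]}),\qquad g(y)=\frac18\Big(y_{[1]}-\frac1{\sqrt q}\Big)^2+\frac18\sum_{j=1}^{q-1}\big(y_{[j+1]}-y_{[j]}\big)^2,$$ where $\psi:\mathbb{R}\to\mathbb{R}$, which satisfies $\psi(0)=\psi'(0)=0$, is the explicit function given in the context. Let $\varphi(x)=\min_{y\in Y^*}f(x,y)$ with $Y^*=\arg\min_{y\in\mathbb{R}^{q}}g(y)$, and let $\mathcal{X}=\{x\in\mathbb{R}:\varphi(x)\le\varphi(0)\}$. There exist numerical constants $c_1,c_2>0$ (independent of $T,K$) such that 1. $f(x,y)$ is $c_1$-Lipschitz in $y$ on $\mathcal{X}\times\mathbb{R}^{d_y}$; 2. $f(x,y)$ has $c_2$-Lipschitz gradients on $\mathcal{X}\times\mathbb{R}^{d_y}$; 3. $g$ is a strictly convex quadratic and has $1$-Lipschitz gradients; 4. $\varphi(x)=(x+1)^2/2$. Moreover, for this problem, any zero-respecting bilevel algorithm (as defined in the context) with initialization $x_0=0,y_0=0$, $T$ outer loops and $K$ inner loops satisfies $x_t=0$ for every $t\le T$.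
   Context: $v_{[j]}$ is the $j$-th coordinate of a vector $v$, and $\mathrm{supp}(v)=\{j:v_{[j]}\ne0\}$. The function $\psi$: let $\beta=1/\sqrt q$ and $$p(y)=-\frac{y^5}{2\beta^3}+\frac{9y^4}{2\beta^2}-\frac{31y^3}{2\beta}+25y^2-18\beta y+5\beta^2.$$ Then $\psi(y)=y^2/2$ if $|y|\le\beta$; $\psi(y)=p(y)$ if $\beta<y\le2\beta$; $\psi(y)=p(-y)$ if $-2\beta\le y<-\beta$; $\psi(y)=\beta^2$ if $|y|>2\beta$. Zero-respecting bilevel algorithm for the problem $\min_{x\in\mathbb{R}^{d_x},\,y\in Y^*}f(x,y)$, $Y^*=\arg\min_y g(y)$: given $x_0=0$, $y_0=0$, it runs for $t=0,\dots,T-1$, and in outer iteration $t$: (i) it generates $y_t^0$ with $\mathrm{supp}(y_t^0)\subseteq\bigcup_{0\le s<t,\ 0\le k\le K}\mathrm{supp}(y_s^k)$ (so $y_0^0=0$); (ii) for $k=0,\dots,K-1$ it generates $y_t^{k+1}$ with $\mathrm{supp}(y_t^{k+1})\subseteq\bigcup_{0\le i\le k}\big(\mathrm{supp}(\nabla_yf(x_t,y_t^i))\cup\mathrm{supp}(\nabla g(y_t^i))\big)$; (iii) it generates $x_{t+1}$ with $\mathrm{supp}(x_{t+1})\subseteq\bigcup_{0\le s\le t}\mathrm{supp}(\nabla_xf(x_s,y_s^K))$. A function has $L$-Lipschitz gradients if it is differentiable with $L$-Lipschitz gradient (Euclidean norms). *)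

(* Defs.v *)
(* MathComp + MathComp-Analysis. *)
From HB Require Import structures.
From mathcomp Require Import all_boot all_order all_algebra.
From mathcomp Require Import all_classical all_reals all_analysis.

Set Implicit Arguments.
Unset Strict Implicit.
Unset Printing Implicit Defensive.

Import Order.TTheory GRing.Theory Num.Theory.
Import numFieldNormedType.Exports.

Local Open Scope classical_set_scope.
Local Open Scope ring_scope.

(* 1-based coordinate v_[j]; it is 0 when j = 0 or j > n. *)
Definition rvcoord (R : realType) (n : nat) (v : 'rV[R]_n) (j : nat) : R :=
  \sum_(i < n | i.+1 == j) v 0 i.

Definition supp (R : realType) (n : nat) (v : 'rV[R]_n) : {set 'I_n} :=
  [set j | v 0 j != 0]%SET.

(* The library norm on 'rV[R]_n is the sup norm, hence this definition. *)
Definition enorm (R : realType) (n : nat) (v : 'rV[R]_n) : R :=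
  Num.sqrt (\sum_(j < n) v 0 j ^+ 2).

Definition grad (R : realType) (n : nat) (F : 'rV[R]_n -> R) (z : 'rV[R]_n) :
    'rV[R]_n :=
  \row_j 'D_(delta_mx 0 j) F z.

Definition grad_x (R : realType) (dx dy : nat)
    (f : 'rV[R]_dx -> 'rV[R]_dy -> R) (x : 'rV[R]_dx) (y : 'rV[R]_dy) :
    'rV[R]_dx :=
  grad (fun x' => f x' y) x.

Definition grad_y (R : realType) (dx dy : nat)
    (f : 'rV[R]_dx -> 'rV[R]_dy -> R) (x : 'rV[R]_dx) (y : 'rV[R]_dy) :
    'rV[R]_dy :=
  grad (fun y' => f x y') y.

(* Differentiability is that of F on the whole space, at the points of D. *)
Definition lipschitz_gradients_on (R : realType) (n : nat) (L : R)
    (D : set 'rV[R]_n) (F : 'rV[R]_n -> R) : Prop :=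
  (forall z, D z -> differentiable F z) /\
  (forall z w, D z -> D w -> enorm (grad F z - grad F w) <= L * enorm (z - w)).

(* f(x, y) as a function of the concatenated vector (x, y), so that its
   gradient is the joint one. *)
Definition joint (R : realType) (dx dy : nat)
    (f : 'rV[R]_dx -> 'rV[R]_dy -> R) (z : 'rV[R]_(dx + dy)) : R :=
  f (lsubmx z) (rsubmx z).

Definition lipschitz_in_y_on (R : realType) (dx dy : nat) (L : R)
    (X : set 'rV[R]_dx) (f : 'rV[R]_dx -> 'rV[R]_dy -> R) : Prop :=
  forall x, X x -> forall y y', `|f x y - f x y'| <= L * enorm (y - y').

Definition is_quadratic (R : realType) (n : nat) (F : 'rV[R]_n -> R) : Prop :=
  exists (A : 'M[R]_n) (b : 'rV[R]_n) (c : R),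
    forall y, F y = (y *m A *m y^T) 0 0 + (b *m y^T) 0 0 + c.

Definition strictly_convex (R : realType) (n : nat) (F : 'rV[R]_n -> R) : Prop :=
  forall (y z : 'rV[R]_n) (t : R), y != z -> 0 < t -> t < 1 ->
    F (t *: y + (1 - t) *: z) < t * F y + (1 - t) * F z.

Definition argmin (R : realType) (n : nat) (g : 'rV[R]_n -> R) : set 'rV[R]_n :=
  [set y | forall z, g y <= g z].

Definition is_minimum (R : realType) (A : set R) (m : R) : Prop :=
  A m /\ lbound A m.

(* The minimum of f x over argmin g.  [inf] only makes it a total function:
   attainment is a separate property, see [is_minimum]. *)
Definition bilevel_value (R : realType) (dx dy : nat)
    (f : 'rV[R]_dx -> 'rV[R]_dy -> R) (g : 'rV[R]_dy -> R) (x : 'rV[R]_dx) : R :=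
  inf [set f x y | y in argmin g].

(* [x t] stands for x_t (0 <= t <= T), [y t k] for y_t^k (t < T, k <= K);
   other values are irrelevant.  [zr_y0] also follows from [zr_outer]. *)
Record zero_respecting (R : realType) (dx dy T K : nat)
    (f : 'rV[R]_dx -> 'rV[R]_dy -> R) (g : 'rV[R]_dy -> R)
    (x : nat -> 'rV[R]_dx) (y : nat -> nat -> 'rV[R]_dy) : Prop := {
  zr_x0 : x 0%N = 0;
  zr_y0 : y 0%N 0%N = 0;
  zr_outer : forall t, (t < T)%N ->
    supp (y t 0%N) \subset (\bigcup_(s < t) \bigcup_(k < K.+1) supp (y s k))%SET;
  zr_inner : forall t k, (t < T)%N -> (k < K)%N ->
    supp (y t k.+1) \subset
      (\bigcup_(i < k.+1)
         (supp (grad_y f (x t) (y t i)) :|: supp (grad g (y t i))))%SET;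
  zr_x : forall t, (t < T)%N ->
    supp (x t.+1) \subset (\bigcup_(s < t.+1) supp (grad_x f (x s) (y s K)))%SET
}.

Definition psi_poly (R : realType) (b y : R) : R :=
  - (y ^+ 5 / (2 * b ^+ 3)) + 9 * y ^+ 4 / (2 * b ^+ 2) - 31 * y ^+ 3 / (2 * b)
  + 25 * y ^+ 2 - 18 * b * y + 5 * b ^+ 2.

Definition psi (R : realType) (b y : R) : R :=
  if `|y| <= b then y ^+ 2 / 2
  else if (b < y) && (y <= 2 * b) then psi_poly b y
  else if (- (2 * b) <= y) && (y < - b) then psi_poly b (- y)
  else b ^+ 2.

Definition hard_beta (R : realType) (q : nat) : R := 1 / Num.sqrt q%:R.

Definition hard_f (R : realType) (q : nat) (x : 'rV[R]_1) (y : 'rV[R]_q) : R :=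
  2 * (x 0 0 + 1) ^+ 2 *
  \sum_(q./2.+1 <= j < q.+1) psi (hard_beta R q) (rvcoord y j).

Definition hard_g (R : realType) (q : nat) (y : 'rV[R]_q) : R :=
  1 / 8 * (rvcoord y 1 - 1 / Num.sqrt q%:R) ^+ 2 +
  1 / 8 * \sum_(1 <= j < q) (rvcoord y j.+1 - rvcoord y j) ^+ 2.

(* Main.v *)
(* The penalty rescales as psi_b(y) = b^2 psi_1(y/b) with b = q^(-1/2), so all
   bounds reduce to b = 1, where psi_1 is glued from polynomial pieces whose
   values and slopes match at the breakpoints.  There psi_b = O(b^2),
   psi_b' = O(b) and psi_b' is O(1)-Lipschitz; since q b^2 = 1, summing over at
   most q coordinates and using Cauchy-Schwarz gives constants free of q.
   The residuals y_1 - b, y_{j+1} - y_j of g determine y, so g is strictly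
   convex with unique minimizer (b, ..., b).  Finally, the gradient of g reveals
   at most one new coordinate per query and that of f none, so y_t^k is
   supported on the first tK + k coordinates; until the end of the run f only
   sees zeros, and its x-gradient vanishes. *)
Require Import Defs.
From HB Require Import structures.
From mathcomp Require Import all_boot all_order all_algebra.
From mathcomp Require Import all_classical all_reals all_analysis.
From mathcomp Require Import ring lra.

Set Implicit Arguments.
Unset Strict Implicit.
Unset Printing Implicit Defensive.

Import Order.TTheory GRing.Theory Num.Theory.
Import numFieldNormedType.Exports.

Local Open Scope classical_set_scope.
Local Open Scope ring_scope.

(** * C^{1,1} functions on subsets of the line: gluing and reflection *)

(* Quantitative stand-in for C^{1,1} regularity of [F] with derivative [dF]: unlike
   differentiability, it makes sense up to the endpoints of a piece, and adjacent
   pieces glue with the same [C]. *)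
Definition C11_on (R : realType) (C : R) (S : set R) (F dF : R -> R) : Prop :=
  forall u v, S u -> S v ->
    [/\ `|F v - F u| <= C * `|v - u|,
        `|dF v - dF u| <= C * `|v - u| &
        `|F v - F u - dF u * (v - u)| <= C * (v - u) ^+ 2].

Lemma C11_on_eq (R : realType) (C : R) (S : set R) (F dF G dG : R -> R) :
  (forall u, S u -> F u = G u /\ dF u = dG u) ->
  C11_on C S G dG -> C11_on C S F dF.
Proof.
move=> FG CG u v Su Sv.
have [[-> ->] [-> ->]] := (FG u Su, FG v Sv).
exact: CG.
Qed.

(** When u and v lie on opposite sides of a, the remainder from u to v is the sum of the remainders
    from u to a and from a to v and of (dF a - dF u)(v - a). That last term has size at most C|a -
    u||v - a|, and the expansion of (v - u)^2 contains this product twice, so C does not grow. *)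
Lemma C11_on_glue (R : realType) (C a : R) (S : set R) (F dF : R -> R) :
  0 <= C -> S a ->
  C11_on C (S `&` [set u | u <= a]) F dF ->
  C11_on C (S `&` [set u | a <= u]) F dF ->
  C11_on C S F dF.
Proof.
move=> C0 Sa Cl Cr u v Su Sv.
have [ua|au] := leP u a; have [va|av] := leP v a.
- by apply: Cl.
- have [l1 l2 l3] := Cl u a (conj Su ua) (conj Sa (lexx a)).
  have [r1 r2 r3] := Cr a v (conj Sa (lexx a)) (conj Sv (ltW av)).
  rewrite (ger0_norm (_ : 0 <= a - u)) in l1 l2; last by lra.
  rewrite (ger0_norm (_ : 0 <= v - a)) in r1 r2; last by lra.
  rewrite (ger0_norm (_ : 0 <= v - u)); last by lra.
  rewrite !ler_norml in l1 l2 l3 r1 r2 r3 *.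
  split; [lra|lra|].
  have hm : 0 <= C * (a - u) * (v - a) by rewrite !mulr_ge0 //; lra.
  have h1 : (dF a - dF u) * (v - a) <= C * (a - u) * (v - a).
    by apply: ler_wpM2r; lra.
  have h2 : - (C * (a - u)) * (v - a) <= (dF a - dF u) * (v - a).
    by apply: ler_wpM2r; lra.
  lra.
- have [l1 l2 l3] := Cl a v (conj Sa (lexx a)) (conj Sv va).
  have [r1 r2 r3] := Cr u a (conj Su (ltW au)) (conj Sa (lexx a)).
  rewrite (ler0_norm (_ : v - a <= 0)) in l1 l2; last by lra.
  rewrite (ler0_norm (_ : a - u <= 0)) in r1 r2; last by lra.
  rewrite (ler0_norm (_ : v - u <= 0)); last by lra.
  rewrite !ler_norml in l1 l2 l3 r1 r2 r3 *.
  split; [lra|lra|].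
  have hm : 0 <= C * (a - v) * (u - a) by rewrite !mulr_ge0 //; lra.
  have h1 : (dF a - dF u) * (a - v) <= C * (u - a) * (a - v).
    by apply: ler_wpM2r; lra.
  have h2 : - (C * (u - a)) * (a - v) <= (dF a - dF u) * (a - v).
    by apply: ler_wpM2r; lra.
  lra.
- by apply: Cr => //; split=> //; exact: ltW.
Qed.

Lemma C11_on_opp (R : realType) (C : R) (S : set R) (F dF : R -> R) :
  C11_on C S F dF ->
  C11_on C [set u | S (- u)] (fun u => F (- u)) (fun u => - dF (- u)).
Proof.
move=> CF u v Su Sv; have [h1 h2 h3] := CF _ _ Su Sv.
have e : `|- v - - u| = `|v - u| by rewrite -normrN opprD !opprK.
rewrite e in h1 h2; split=> //.
  by rewrite -normrN opprD !opprK.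
have -> : (v - u) ^+ 2 = (- v - - u) ^+ 2 by ring.
by have -> : - dF (- u) * (v - u) = dF (- u) * (- v - - u) by ring.
Qed.

(** * The penalty at scale b = 1 *)

Definition dpsi_poly (R : realType) (y : R) : R :=
  - (5 / 2 * y ^+ 4) + 18 * y ^+ 3 - 93 / 2 * y ^+ 2 + 50 * y - 18.

Lemma psi_poly1 (R : realType) (y : R) :
  psi_poly 1 y = - (1 / 2 * y ^+ 5) + 9 / 2 * y ^+ 4 - 31 / 2 * y ^+ 3
    + 25 * y ^+ 2 - 18 * y + 5.
Proof. by rewrite /psi_poly; field. Qed.

(** Each of the three differences has an exact factor v - u or (v - u)^2, and the cofactor is a
    polynomial bounded crudely for u, v in [0, 2]; the constant 1000 is generous. *)
Lemma C11_psi_poly (R : realType) :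
  C11_on 1000 [set u : R | 1 <= u <= 2] (psi_poly 1) (@dpsi_poly R).
Proof.
move=> u v /= /andP[u1 u2] /andP[v1 v2]; rewrite !psi_poly1 /dpsi_poly.
(* Every monomial in u, v of degree 2 to 4 lies between 0 and 2 to its degree. With these bounds at
   hand, the estimates of the cofactors are linear in the monomials. *)
have M : forall (a b c d : R), 0 <= a <= c -> 0 <= b <= d -> 0 <= a * b <= c * d.
  move=> a b c d /andP[a0 ac] /andP[b0 bd].
  by rewrite mulr_ge0//= ler_pM.
have hu : 0 <= u <= 2 by lra.
have hv : 0 <= v <= 2 by lra.
have huu := M _ _ _ _ hu hu; have huv := M _ _ _ _ hu hv.
have hvv := M _ _ _ _ hv hv.
have huuu := M _ _ _ _ hu huu; have huuv := M _ _ _ _ hu huv.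
have huvv := M _ _ _ _ hu hvv; have hvvv := M _ _ _ _ hv hvv.
have h40 := M _ _ _ _ hu huuu; have h31 := M _ _ _ _ hu huuv.
have h22 := M _ _ _ _ hu huvv; have h13 := M _ _ _ _ hu hvvv.
have h04 := M _ _ _ _ hv hvvv.
split.
- set e := (X in `|X|).
  have -> : e = (- (1 / 2) * (v * (v * (v * v)) + u * (v * (v * v))
     + u * (u * (v * v)) + u * (u * (u * v)) + u * (u * (u * u)))
     + 9 / 2 * (v * (v * v) + u * (v * v) + u * (u * v) + u * (u * u))
     - 31 / 2 * (v * v + u * v + u * u) + 25 * (u + v) - 18) * (v - u).
    by rewrite /e; field.
  rewrite normrM ler_wpM2r// ler_norml; lra.
- set e := (X in `|X|).
  have -> : e = (- (5 / 2) * (v * (v * v) + u * (v * v) + u * (u * v) + u * (u * u))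
     + 18 * (v * v + u * v + u * u) - 93 / 2 * (u + v) + 50) * (v - u).
    by rewrite /e; field.
  rewrite normrM ler_wpM2r// ler_norml; lra.
- set e := (X in `|X|).
  have -> : e = (- (1 / 2) * (v * (v * v) + 2 * (u * (v * v)) + 3 * (u * (u * v))
       + 4 * (u * (u * u))) + 9 / 2 * (v * v + 2 * (u * v) + 3 * (u * u))
     - 31 / 2 * (v + 2 * u) + 25) * (v - u) ^+ 2.
    by rewrite /e; field.
  rewrite normrM (ger0_norm (sqr_ge0 _)) ler_wpM2r ?sqr_ge0// ler_norml; lra.
Qed.

Definition dpsi1 (R : realType) (y : R) : R :=
  if `|y| <= 1 then y
  else if (1 < y) && (y <= 2) then dpsi_poly y
  else if (- 2 <= y) && (y < - 1) then - dpsi_poly (- y)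
  else 0.

Lemma psi1_mid (R : realType) (y : R) : -1 <= y <= 1 ->
  psi 1 y = y ^+ 2 / 2 /\ dpsi1 y = y.
Proof. by move=> h; rewrite /psi /dpsi1 ler_norml h. Qed.

(** The definitions give the breakpoint 1 to the quadratic branch, but the polynomial also has value
    1/2 and slope 1 there; at 2 it has value 1 and slope 0. The pieces can thus be taken closed,
    with shared endpoints, as gluing requires. *)
Lemma psi1_right (R : realType) (y : R) : 1 <= y <= 2 ->
  psi 1 y = psi_poly 1 y /\ dpsi1 y = dpsi_poly y.
Proof.
move=> /andP[y1 y2]; rewrite /psi /dpsi1 ger0_norm; last by lra.
rewrite mulr1 y2 andbT.
move: y1; rewrite le_eqVlt => /predU1P[<-|y1].
  by rewrite lexx psi_poly1 /dpsi_poly; split; field.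
by rewrite y1 leNgt y1.
Qed.

Lemma psi1_left (R : realType) (y : R) : -2 <= y <= -1 ->
  psi 1 y = psi_poly 1 (- y) /\ dpsi1 y = - dpsi_poly (- y).
Proof.
move=> /andP[y2 y1]; rewrite /psi /dpsi1 ler0_norm; last by lra.
rewrite mulr1 y2 andTb.
have -> : (1 < y) = false by apply/negbTE; rewrite -leNgt; lra.
rewrite andFb; move: y1; rewrite le_eqVlt => /predU1P[->|y1].
  by rewrite opprK lexx psi_poly1 /dpsi_poly; split; field.
rewrite y1 leNgt; suff -> : 1 < - y by [].
lra.
Qed.

Lemma psi1_out (R : realType) (y : R) : 2 <= `|y| ->
  psi 1 y = 1 /\ dpsi1 y = 0.
Proof.
move=> hy; rewrite /psi /dpsi1 mulr1 leNgt (lt_le_trans _ hy) /=; last by lra.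
case: ifP => [/andP[y1 y2]|_].
  have -> : y = 2 by apply/eqP; rewrite eq_le y2/= -[y]ger0_norm//; lra.
  by rewrite psi_poly1 /dpsi_poly; split; field.
case: ifP => [/andP[y2 y1]|_]; last by rewrite expr1n.
have -> : y = -2.
  by apply/eqP; rewrite eq_le y2 andbT -lerN2 opprK -[- y]ger0_norm ?normrN//; lra.
by rewrite opprK psi_poly1 /dpsi_poly; split; field.
Qed.

Lemma C11_on_cst (R : realType) (C c : R) (S : set R) : 0 <= C ->
  C11_on C S (fun=> c) (fun=> 0).
Proof.
move=> C0 u v _ _; rewrite !subrr mul0r subr0 normr0.
by split; apply: mulr_ge0 => //; exact: sqr_ge0.
Qed.

Lemma C11_on_sub (R : realType) (C : R) (S S' : set R) (F dF : R -> R) :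
  S' `<=` S -> C11_on C S F dF -> C11_on C S' F dF.
Proof. by move=> SS' CF u v Su Sv; apply: CF; exact: SS'. Qed.

Lemma C11_psi1_out (R : realType) :
  C11_on 1000 [set u : R | 2 <= `|u|] (psi 1) (@dpsi1 R).
Proof.
apply: (C11_on_eq (G := fun=> 1) (dG := fun=> 0)); first exact: psi1_out.
by apply: C11_on_cst; lra.
Qed.

Lemma C11_psi1_left (R : realType) :
  C11_on 1000 [set u : R | -2 <= u <= -1] (psi 1) (@dpsi1 R).
Proof.
apply: C11_on_eq; first exact: psi1_left.
apply: C11_on_sub (C11_on_opp (@C11_psi_poly R)) => u /andP[u2 u1].
by apply/andP; rewrite lerNr lerNl.
Qed.

Lemma C11_psi1_right (R : realType) :
  C11_on 1000 [set u : R | 1 <= u <= 2] (psi 1) (@dpsi1 R).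
Proof. apply: C11_on_eq (@C11_psi_poly R); exact: psi1_right. Qed.

Lemma C11_psi1_mid (R : realType) :
  C11_on 1000 [set u : R | -1 <= u <= 1] (psi 1) (@dpsi1 R).
Proof.
apply: (C11_on_eq (G := fun u => u ^+ 2 / 2) (dG := id)); first exact: psi1_mid.
move=> u v /andP[u1 u2] /andP[v1 v2]; split.
- have -> : v ^+ 2 / 2 - u ^+ 2 / 2 = (v + u) / 2 * (v - u) by field.
  by rewrite normrM ler_wpM2r// ler_norml; lra.
- have := normr_ge0 (v - u); lra.
- have -> : v ^+ 2 / 2 - u ^+ 2 / 2 - u * (v - u) = 1 / 2 * (v - u) ^+ 2 by field.
  by rewrite normrM (ger0_norm (sqr_ge0 _)) ler_wpM2r ?sqr_ge0// ler_norml; lra.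
Qed.

Lemma C11_psi1 (R : realType) : C11_on 1000 setT (psi (1 : R)) (@dpsi1 R).
Proof.
have c0 : 0 <= 1000 :> R by lra.
have le12 : -2 <= -1 :> R by lra.
have le11 : -1 <= 1 :> R by lra.
have le1_2 : 1 <= 2 :> R by lra.
apply: (@C11_on_glue _ _ (-1)) => //.
  apply: (@C11_on_glue _ _ (-2)) => //.
    apply: C11_on_sub (@C11_psi1_out R) => u [_ u2].
    by rewrite /mkset -normrN (le_trans _ (ler_norm _))// lerNr.
  apply: C11_on_sub (@C11_psi1_left R) => u [[_ u1] u2].
  exact/andP.
apply: (@C11_on_glue _ _ 1) => //.
  apply: C11_on_sub (@C11_psi1_mid R) => u [[_ u1] u2].
  exact/andP.
apply: (@C11_on_glue _ _ 2) => //.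
- by split=> //; split=> //; exact: le_trans le1_2.
- apply: C11_on_sub (@C11_psi1_right R) => u [[_ u1] u2].
  exact/andP.
- apply: C11_on_sub (@C11_psi1_out R) => u [_ u2].
  by rewrite /mkset (le_trans _ (ler_norm _)).
Qed.

(** For |u| >= 2 the values are the constants 1 and 0. Otherwise, comparison with the point 0, where
    both functions vanish, gives 1000 times a distance of at most 2. *)
Lemma psi1_bound (R : realType) (u : R) :
  `|psi 1 u| <= 2000 /\ `|dpsi1 u| <= 2000.
Proof.
have [h|h] := leP 2 `|u|.
  have [-> ->] := psi1_out h; rewrite normr1 normr0; lra.
have [p0 d0] : psi 1 (0 : R) = 0 /\ dpsi1 (0 : R) = 0.
  have [-> ->] := @psi1_mid R 0 ltac:(lra).
  by split; field.
have [] := @C11_psi1 R 0 u I I; rewrite p0 d0 !subr0 => hp hd _.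
split; [apply: le_trans hp _|apply: le_trans hd _]; lra.
Qed.

(** * Rescaling to general b *)

Definition dpsi (R : realType) (b y : R) : R := b * dpsi1 (y / b).

Lemma psi_scale (R : realType) (b y : R) : 0 < b ->
  psi b y = b ^+ 2 * psi 1 (y / b).
Proof.
move=> b0; have bN0 : b != 0 by rewrite gt_eqF.
rewrite /psi normrM normfV (gtr0_norm b0) !mulr1.
rewrite ler_pdivrMr// mul1r ltr_pdivlMr// mul1r ler_pdivrMr//.
rewrite ler_pdivlMr// ltr_pdivrMr// mulNr mulN1r.
case: ifP => _; first by field.
case: ifP => _; first by rewrite psi_poly1 /psi_poly; field.
case: ifP => _; first by rewrite psi_poly1 /psi_poly; field.
by rewrite expr1n mulr1.
Qed.

(** Dominates both the size bound 2000 and the Lipschitz constant 1000 found at scale 1, so that one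
    constant runs through all estimates. *)
Definition psi_const (R : realType) : R := 2000.

Lemma psi_const_gt0 (R : realType) : 0 < psi_const R.
Proof. by rewrite /psi_const ltr0n. Qed.

Lemma psi_bound (R : realType) (b y : R) : 0 < b -> `|psi b y| <= psi_const R * b ^+ 2.
Proof.
move=> b0; rewrite (psi_scale y b0) normrM (ger0_norm (sqr_ge0 _)) mulrC.
by rewrite ler_wpM2r ?sqr_ge0// (psi1_bound _).1.
Qed.

Lemma dpsi_bound (R : realType) (b y : R) : 0 < b -> `|dpsi b y| <= psi_const R * b.
Proof.
move=> b0; rewrite normrM (gtr0_norm b0) mulrC.
by rewrite ler_wpM2r ?(ltW b0)// (psi1_bound _).2.
Qed.

Lemma psi_lipschitz (R : realType) (b y z : R) : 0 < b ->
  `|psi b y - psi b z| <= psi_const R * b * `|y - z|.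
Proof.
move=> b0; have [h _ _] := @C11_psi1 R (z / b) (y / b) I I.
rewrite (psi_scale y b0) (psi_scale z b0) -mulrBr normrM (ger0_norm (sqr_ge0 _)).
apply: le_trans (ler_wpM2l (sqr_ge0 _) h) _.
rewrite -mulrBl normrM normfV (gtr0_norm b0).
have e (c : R) : b ^+ 2 * (c * (`|y - z| / b)) = c * b * `|y - z|.
  by field; rewrite gt_eqF.
rewrite e.
by rewrite ler_wpM2r// ler_wpM2r ?ltW//; lra.
Qed.

Lemma dpsi_lipschitz (R : realType) (b y z : R) : 0 < b ->
  `|dpsi b y - dpsi b z| <= psi_const R * `|y - z|.
Proof.
move=> b0; have [_ h _] := @C11_psi1 R (z / b) (y / b) I I.
rewrite -mulrBr normrM (gtr0_norm b0).
apply: le_trans (ler_wpM2l (ltW b0) h) _.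
rewrite -mulrBl normrM normfV (gtr0_norm b0).
have e (c : R) : b * (c * (`|y - z| / b)) = c * `|y - z|.
  by field; rewrite gt_eqF.
rewrite e.
by rewrite ler_wpM2r//; rewrite /psi_const; lra.
Qed.

Lemma psi0 (R : realType) (b : R) : 0 < b -> psi b 0 = 0.
Proof. by move=> b0; rewrite /psi normr0 ltW// expr0n mul0r. Qed.

Lemma dpsi0 (R : realType) (b : R) : dpsi b 0 = 0.
Proof. by rewrite /dpsi /dpsi1 mul0r normr0 ler01 mulr0. Qed.

Lemma psi_self (R : realType) (b : R) : 0 < b -> psi b b = b ^+ 2 / 2.
Proof. by move=> b0; rewrite /psi gtr0_norm// lexx. Qed.

(** The difference quotient with increment t misses d by at most C|t|. Applied to [psi], this treats
    the breakpoints like any other point. *)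
Lemma is_derive_quadratic_remainder (R : realType) (C d u : R) (F : R -> R) :
  (forall v, `|F v - F u - d * (v - u)| <= C * (v - u) ^+ 2) ->
  is_derive u 1 F d.
Proof.
move=> H.
suff h : (fun h => h^-1 *: ((F \o shift u) (h *: (1 : R)) - F u)) @ 0^' --> d.
  by apply: DeriveDef; [apply/cvg_ex; exists d|exact: cvg_lim].
apply/cvgrPdist_le => e e0.
have C0 : 0 <= C.
  have := H (u + 1); rewrite (_ : u + 1 - u = 1); last by ring.
  by rewrite expr1n !mulr1 => h; exact: le_trans (normr_ge0 _) h.
near=> t.
have t0 : t != 0 by near: t; exact: nbhs_dnbhs_neq.
(* Dividing by C + 1 rather than by C covers the case C = 0 as well. *)
have te : `|t| <= e / (C + 1).
  near: t; apply: dnbhs0_le; rewrite divr_gt0//; lra.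
rewrite /= -[_%:A]/(t * 1) mulr1 -[_ *: _]/(t^-1 * _).
have := H (t + u); rewrite addrK => Ht.
have -> : d - t^-1 * (F (t + u) - F u) = - (t^-1 * (F (t + u) - F u - d * t)).
  by field.
rewrite normrN normrM normfV ler_pdivrMl ?normr_gt0//.
apply: le_trans Ht _; rewrite -[t ^+ 2]ger0_norm ?sqr_ge0// normrX expr2 mulrCA.
rewrite ler_wpM2l//; apply: le_trans (ler_wpM2l C0 te) _.
by rewrite mulrCA ger_pMr// ler_pdivrMr; lra.
Unshelve. all: by end_near. Qed.

(** The factor b^2 of the scaling cancels the squared 1/b of the remainder, so the constant 1000
    serves for every b. *)
Lemma is_derive_psi (R : realType) (b y : R) : 0 < b ->
  is_derive y (1 : R) (psi b) (dpsi b y).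
Proof.
move=> b0; apply: (is_derive_quadratic_remainder (C := 1000)) => z.
have [_ _] := @C11_psi1 R (y / b) (z / b) I I.
rewrite (psi_scale y b0) (psi_scale z b0) /dpsi => h.
have -> : b ^+ 2 * psi 1 (z / b) - b ^+ 2 * psi 1 (y / b)
    - b * dpsi1 (y / b) * (z - y)
  = b ^+ 2 * (psi 1 (z / b) - psi 1 (y / b) - dpsi1 (y / b) * (z / b - y / b)).
  by field; rewrite gt_eqF.
rewrite normrM ger0_norm ?sqr_ge0//.
apply: le_trans (ler_wpM2l (sqr_ge0 _) h) _.
have e (c : R) : b ^+ 2 * (c * (z / b - y / b) ^+ 2) = c * (z - y) ^+ 2.
  by field; rewrite gt_eqF.
by rewrite e.
Qed.

Lemma is_diff_psi (R : realType) (b y : R) : 0 < b ->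
  is_diff_def (Phantom _ (nbhs y)) (psi b) (fun h => dpsi b y * h).
Proof.
move=> b0; have dy := is_derive_psi y b0.
have dd : derivable (psi b) y 1 by exact: ex_derive.
apply: DiffDef; first exact/derivable1_diffP.
apply/funext => h; rewrite diff1E; last exact/derivable1_diffP.
by rewrite derive1E derive_val /= mulrC.
Qed.

(** * Coordinates and differentials on row vectors *)

Lemma rvcoordS (R : realType) (n : nat) (v : 'rV[R]_n) (i : 'I_n) :
  rvcoord v i.+1 = v 0 i.
Proof.
by rewrite /rvcoord (eq_bigl (pred1 i)) ?big_pred1_eq// => j; rewrite eqSS.
Qed.

Lemma rvcoord_default (R : realType) (n : nat) (v : 'rV[R]_n) (j : nat) :
  (j == 0)%N || (n < j)%N -> rvcoord v j = 0.
Proof.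
move=> hj; rewrite /rvcoord big1// => i /eqP ij.
by move: hj; rewrite -ij /= ltnNge ltn_ord.
Qed.

Lemma rvcoord_linear (R : realType) (n : nat) (u v : 'rV[R]_n) (a b : R) (j : nat) :
  rvcoord (a *: u + b *: v) j = a * rvcoord u j + b * rvcoord v j.
Proof.
rewrite /rvcoord !mulr_sumr -big_split/=.
by apply: eq_bigr => i _; rewrite !mxE.
Qed.

Lemma rvcoordB (R : realType) (n : nat) (u v : 'rV[R]_n) (j : nat) :
  rvcoord (u - v) j = rvcoord u j - rvcoord v j.
Proof.
by have := rvcoord_linear u v 1 (-1) j; rewrite !scale1r scaleN1r mul1r mulN1r.
Qed.

Lemma rvcoord_delta (R : realType) (n : nat) (k : 'I_n) (j : nat) :
  rvcoord (delta_mx 0 k : 'rV[R]_n) j = (j == k.+1)%:R.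
Proof.
rewrite /rvcoord big_mkcond (bigD1 k)//= big1 ?addr0.
  by rewrite !mxE !eqxx eq_sym; case: eqP.
by move=> i ik; rewrite !mxE (negbTE ik) if_same.
Qed.

(** The gradients below are all obtained by exhibiting an explicit differential and evaluating it at
    a basis vector. *)
Lemma grad_is_diff (R : realType) (n : nat) (F dF : 'rV[R]_n -> R) (z : 'rV[R]_n)
    (j : 'I_n) :
  is_diff_def (Phantom _ (nbhs z)) F dF -> grad F z 0 j = dF (delta_mx 0 j).
Proof. by move=> dz; rewrite mxE deriveE// diff_val. Qed.

Lemma is_diff_sum (R : realType) (V : normedModType R) (I : Type) (r : seq I)
    (P : pred I) (F dF : I -> V -> R) (z : V) :
  (forall i, P i -> is_diff_def (Phantom _ (nbhs z)) (F i) (dF i)) ->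
  is_diff_def (Phantom _ (nbhs z)) (fun x => \sum_(i <- r | P i) F i x)
    (fun h => \sum_(i <- r | P i) dF i h).
Proof.
move=> H; elim: r => [|i r IH].
  have e (G : I -> V -> R) : (fun x => \sum_(i <- [::] | P i) G i x) = cst 0.
    by apply/funext => x; rewrite big_nil.
  by rewrite !e; exact: is_diff_cst.
have e (G : I -> V -> R) : (fun x => \sum_(j <- i :: r | P j) G j x) =
    if P i then G i + (fun x => \sum_(j <- r | P j) G j x)
    else fun x => \sum_(j <- r | P j) G j x.
  by apply/funext => x; rewrite big_cons; case: ifP.
rewrite !e; case: ifPn => // Pi; have := H i Pi => Hi.
exact: is_diffD.
Qed.

Lemma is_diff_mul (R : realType) (V : normedModType R) (F dF G dG : V -> R) (z : V) :
  is_diff_def (Phantom _ (nbhs z)) F dF -> is_diff_def (Phantom _ (nbhs z)) G dG ->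
  is_diff_def (Phantom _ (nbhs z)) (fun x => F x * G x)
    (fun h => F z * dG h + G z * dF h).
Proof. exact: is_diffM. Qed.

Lemma is_diff_scale (R : realType) (V : normedModType R) (c : R) (F dF : V -> R) (z : V) :
  is_diff_def (Phantom _ (nbhs z)) F dF ->
  is_diff_def (Phantom _ (nbhs z)) (fun x => c * F x) (fun h => c * dF h).
Proof. exact: is_diffZ. Qed.

Lemma is_diff_sqr (R : realType) (V : normedModType R) (c : R) (F dF : V -> R) (z : V) :
  is_diff_def (Phantom _ (nbhs z)) F dF ->
  is_diff_def (Phantom _ (nbhs z)) (fun x => (F x + c) ^+ 2)
    (fun h => 2 * (F z + c) * dF h).
Proof.
move=> dz.
have dc : is_diff_def (Phantom _ (nbhs z)) (fun x => F x + c) dF.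
  have -> : dF = dF + 0 by rewrite addr0.
  exact: is_diffD dz (is_diff_cst c z).
have -> : (fun h => 2 * (F z + c) * dF h) =
    (fun h => (F z + c) * dF h + (F z + c) * dF h) by apply/funext => h; ring.
exact: (is_diff_mul dc dc).
Qed.

Lemma is_diff_coord (R : realType) (n : nat) (i : 'I_n) (z : 'rV[R]_n) :
  is_diff_def (Phantom _ (nbhs z)) (fun v : 'rV[R]_n => v 0 i) (fun v => v 0 i).
Proof.
have @f : {linear 'rV[R]_n -> R}.
  by exists (fun N : 'rV[R]_n => N 0 i); do 2![eexists]; do ?[constructor];
     rewrite ?mxE// => ? *; rewrite ?mxE//; move=> ?; rewrite !mxE.
have cf : continuous f by exact: coord_continuous.
rewrite (_ : (fun _ => _) = f)//; apply: DiffDef.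
  exact: linear_differentiable.
exact: diff_lin.
Qed.

Lemma is_diff_rvcoord (R : realType) (n j : nat) (z : 'rV[R]_n) :
  is_diff_def (Phantom _ (nbhs z)) (fun v : 'rV[R]_n => rvcoord v j)
    (fun v => rvcoord v j).
Proof. by apply: is_diff_sum => i _; exact: is_diff_coord. Qed.

(** * Gradients of f *)

Lemma hard_beta_gt0 (R : realType) (q : nat) : (0 < q)%N -> 0 < hard_beta R q.
Proof. by move=> q0; rewrite divr_gt0// sqrtr_gt0 ltr0n. Qed.

Lemma hard_beta_sqr (R : realType) (q : nat) : (0 < q)%N ->
  q%:R * hard_beta R q ^+ 2 = 1.
Proof.
move=> q0; rewrite /hard_beta expr_div_n expr1n sqr_sqrtr// mulrA mulr1 divff//.
by rewrite pnatr_eq0 -lt0n.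
Qed.

(** Matrix indices start at 0, so q/2 <= i selects the 1-based coordinates q/2 + 1, ..., q. *)
Definition psi_sum (R : realType) (q : nat) (y : 'rV[R]_q) : R :=
  \sum_(i < q | (q./2 <= i)%N) psi (hard_beta R q) (y 0 i).

Lemma hard_fE (R : realType) (q : nat) (x : 'rV[R]_1) (y : 'rV[R]_q) :
  hard_f x y = 2 * (x 0 0 + 1) ^+ 2 * psi_sum y.
Proof.
rewrite /hard_f big_add1/= big_geq_mkord; congr (_ * _).
by apply: eq_bigr => i _; rewrite rvcoordS.
Qed.

(** The coordinate functions F i are left general so that the result serves both for y alone and for
    the y-block of the concatenated vector (x, y). *)
Lemma is_diff_psi_sum (R : realType) (V : normedModType R) (q : nat)
    (F dF : 'I_q -> V -> R) (z : V) :
  (0 < q)%N ->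
  (forall i, is_diff_def (Phantom _ (nbhs z)) (F i) (dF i)) ->
  is_diff_def (Phantom _ (nbhs z)) (fun u => psi_sum (\row_i F i u))
    (fun h => \sum_(i < q | (q./2 <= i)%N) dpsi (hard_beta R q) (F i z) * dF i h).
Proof.
move=> q0 dF_z.
have -> : (fun u => psi_sum (\row_i F i u)) =
    fun u => \sum_(i < q | (q./2 <= i)%N) (psi (hard_beta R q) \o F i) u.
  by apply/funext => u; apply: eq_bigr => i _; rewrite mxE.
apply: is_diff_sum => i _.
have dpsi_i := is_diff_psi (F i z) (hard_beta_gt0 R q0).
exact: is_diff_comp.
Qed.

Lemma grad_x_hard_f (R : realType) (q : nat) (x : 'rV[R]_1) (y : 'rV[R]_q) :
  grad_x (@hard_f R q) x y 0 0 = 4 * (x 0 0 + 1) * psi_sum y.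
Proof.
have d := is_diff_scale (2 * psi_sum y) (is_diff_sqr 1 (is_diff_coord 0 x)).
rewrite /grad_x (_ : (fun _ => _) =
  fun x' : 'rV[R]_1 => 2 * psi_sum y * (x' 0 0 + 1) ^+ 2); last first.
  by apply/funext => x'; rewrite hard_fE; ring.
by rewrite (grad_is_diff _ d) !mxE !eqxx /=; ring.
Qed.

Lemma grad_y_hard_f (R : realType) (q : nat) (x : 'rV[R]_1) (y : 'rV[R]_q)
    (k : 'I_q) : (0 < q)%N ->
  grad_y (@hard_f R q) x y 0 k =
  if (q./2 <= k)%N then 2 * (x 0 0 + 1) ^+ 2 * dpsi (hard_beta R q) (y 0 k) else 0.
Proof.
move=> q0.
have d := is_diff_scale (2 * (x 0 0 + 1) ^+ 2)
  (is_diff_psi_sum q0 (fun i => is_diff_coord i y)).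
rewrite /grad_y (_ : (fun _ => _) =
  fun y' : 'rV[R]_q => 2 * (x 0 0 + 1) ^+ 2 * psi_sum (\row_i y' 0 i)); last first.
  apply/funext => y'; rewrite hard_fE; congr (_ * psi_sum _).
  by apply/rowP => i; rewrite mxE.
rewrite (grad_is_diff _ d) big_mkcond (bigD1 k)//= big1 ?addr0.
  by case: ifP; rewrite ?mulr0// !mxE !eqxx mulr1.
by move=> i ik; rewrite !mxE (negbTE ik) andbF mulr0 if_same.
Qed.

Lemma is_diff_joint_hard_f (R : realType) (q : nat) (z : 'rV[R]_(1 + q)) :
  (0 < q)%N ->
  is_diff_def (Phantom _ (nbhs z)) (joint (@hard_f R q))
    (fun h => 2 * (lsubmx z 0 0 + 1) ^+ 2 *
        \sum_(i < q | (q./2 <= i)%N)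
          dpsi (hard_beta R q) (rsubmx z 0 i) * rsubmx h 0 i +
      psi_sum (rsubmx z) * (4 * (lsubmx z 0 0 + 1) * lsubmx h 0 0)).
Proof.
move=> q0.
have dl (i : 'I_1) : is_diff_def (Phantom _ (nbhs z))
    (fun v : 'rV[R]_(1 + q) => lsubmx v 0 i) (fun v => lsubmx v 0 i).
  rewrite (_ : (fun v => _) = fun v : 'rV[R]_(1 + q) => v 0 (lshift q i)).
    exact: is_diff_coord.
  by apply/funext => v; rewrite mxE.
have dr (i : 'I_q) : is_diff_def (Phantom _ (nbhs z))
    (fun v : 'rV[R]_(1 + q) => rsubmx v 0 i) (fun v => rsubmx v 0 i).
  rewrite (_ : (fun v => _) = fun v : 'rV[R]_(1 + q) => v 0 (rshift 1 i)).
    exact: is_diff_coord.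
  by apply/funext => v; rewrite mxE.
have row_rsub (v : 'rV[R]_(1 + q)) : \row_i rsubmx v 0 i = rsubmx v.
  by apply/rowP => i; rewrite mxE.
have d := is_diff_mul (is_diff_scale 2 (is_diff_sqr 1 (dl 0))) (is_diff_psi_sum q0 dr).
rewrite (_ : joint _ = fun v => 2 * (lsubmx v 0 0 + 1) ^+ 2 *
    psi_sum (\row_i rsubmx v 0 i)); last first.
  by apply/funext => v; rewrite /joint hard_fE row_rsub.
apply: is_diff_eq d _; apply/funext => h; rewrite row_rsub; congr (_ + _ * _).
ring.
Qed.

Lemma grad_joint_hard_f_l (R : realType) (q : nat) (z : 'rV[R]_(1 + q)) :
  (0 < q)%N ->
  grad (joint (@hard_f R q)) z 0 (lshift q 0) =
  4 * (lsubmx z 0 0 + 1) * psi_sum (rsubmx z).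
Proof.
move=> q0; rewrite (grad_is_diff _ (is_diff_joint_hard_f z q0)).
rewrite big1 => [|i _].
  rewrite mulr0 add0r [lsubmx (delta_mx _ _) 0 0]mxE [delta_mx _ _ _ _]mxE.
  by rewrite !eqxx /=; ring.
by rewrite [rsubmx (delta_mx _ _) 0 i]mxE [delta_mx _ _ _ _]mxE eq_rlshift andbF mulr0.
Qed.

Lemma grad_joint_hard_f_r (R : realType) (q : nat) (z : 'rV[R]_(1 + q)) (k : 'I_q) :
  (0 < q)%N ->
  grad (joint (@hard_f R q)) z 0 (rshift 1 k) =
  if (q./2 <= k)%N
  then 2 * (lsubmx z 0 0 + 1) ^+ 2 * dpsi (hard_beta R q) (rsubmx z 0 k) else 0.
Proof.
move=> q0; rewrite (grad_is_diff _ (is_diff_joint_hard_f z q0)).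
rewrite [lsubmx (delta_mx _ _) 0 0]mxE [delta_mx _ _ _ _]mxE eq_lrshift andbF.
rewrite !mulr0 addr0 big_mkcond (bigD1 k)//= big1 ?addr0.
  rewrite [rsubmx (delta_mx _ _) 0 k]mxE [delta_mx _ _ _ _]mxE.
  by case: ifP; rewrite ?mulr0// !eqxx mulr1.
move=> i ik; rewrite [rsubmx (delta_mx _ _) 0 i]mxE [delta_mx _ _ _ _]mxE.
rewrite eq_rshift (negbTE ik).
by rewrite andbF mulr0 if_same.
Qed.

(** * Residuals and gradient of g *)

(* Up to the factor 1/8, g is the sum of the squares of these residuals.  Setting
   them to 0 from [j = q] on makes the last component of the gradient of g an
   ordinary difference. *)
Definition chain (R : realType) (q : nat) (y : 'rV[R]_q) (j : nat) : R :=
  if (j < q)%N then rvcoord y j.+1 - rvcoord y j - (j == 0%N)%:R * hard_beta R q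
  else 0.

Lemma hard_gE (R : realType) (q : nat) (y : 'rV[R]_q) : (0 < q)%N ->
  hard_g y = 1 / 8 * \sum_(j < q) chain y j ^+ 2.
Proof.
move=> q0; rewrite /hard_g -mulrDr -(big_mkord xpredT (fun j => chain y j ^+ 2)).
rewrite big_ltn//; congr (_ * (_ + _)).
  (* Since [rvcoord y 0] is 0 by default, residual 0 is y_1 - b. *)
  by rewrite /chain q0 eqxx (mul1r (hard_beta _ _)) (@rvcoord_default _ _ _ 0%N isT) subr0.
apply: eq_big_nat => j /andP[j0 jq].
by rewrite /chain jq (gtn_eqF j0) mul0r subr0.
Qed.

Lemma is_diff_hard_g (R : realType) (q : nat) (y : 'rV[R]_q) : (0 < q)%N ->
  is_diff_def (Phantom _ (nbhs y)) (@hard_g R q)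
    (fun h => 1 / 8 * \sum_(j < q) 2 * chain y j * (rvcoord h j.+1 - rvcoord h j)).
Proof.
move=> q0; rewrite (_ : @hard_g R q = fun v => 1 / 8 * \sum_(j < q) chain v j ^+ 2).
  apply: is_diff_scale; apply: is_diff_sum => j _.
  rewrite /chain ltn_ord.
  apply: is_diff_sqr.
  have d1 := is_diff_rvcoord j.+1 y; have d2 := is_diff_rvcoord j y.
  exact: is_diffB.
by apply/funext => v; exact: hard_gE.
Qed.

(** The 1-based coordinate k + 1 enters only residual k, with coefficient 1, and residual k + 1,
    with coefficient -1. *)
Lemma grad_hard_g (R : realType) (q : nat) (y : 'rV[R]_q) (k : 'I_q) : (0 < q)%N ->
  grad (@hard_g R q) y 0 k = 1 / 4 * (chain y k - chain y k.+1).
Proof.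
move=> q0; rewrite (grad_is_diff _ (is_diff_hard_g y q0)).
have e : chain y k - chain y k.+1 = \sum_(j < q)
    chain y j * (rvcoord (delta_mx 0 k : 'rV[R]_q) j.+1 - rvcoord (delta_mx 0 k : 'rV[R]_q) j).
  under eq_bigr do rewrite !rvcoord_delta eqSS mulrBr.
  rewrite sumrB; congr (_ - _).
    rewrite (bigD1 k)//= eqxx mulr1 big1 ?addr0// => i ik.
    by rewrite (_ : (_ == _ :> nat) = false) ?mulr0//; exact/negbTE.
  (* For the last coordinate the sum has no residual k + 1, in agreement with the default value 0 of
     [chain]. *)
  have [kq|kq] := ltnP k.+1 q; last first.
    rewrite {1}/chain ltnNge kq big1// => i _.
    rewrite (_ : (_ == _) = false) ?mulr0//; apply/negbTE.
    by rewrite neq_ltn (leq_trans (ltn_ord i) kq).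
  rewrite (bigD1 (Ordinal kq))//= eqxx mulr1 big1 ?addr0// => i ik.
  by rewrite (_ : (_ == _ :> nat) = false) ?mulr0//; exact/negbTE.
rewrite e !mulr_sumr; by apply: eq_bigr => j _; field.
Qed.

(** * Euclidean norm and dimension-free bounds for f *)

Lemma enorm_sqr (R : realType) (n : nat) (v : 'rV[R]_n) :
  enorm v ^+ 2 = \sum_(j < n) v 0 j ^+ 2.
Proof. by rewrite sqr_sqrtr// sumr_ge0// => j _; exact: sqr_ge0. Qed.

Lemma enorm_ge0 (R : realType) (n : nat) (v : 'rV[R]_n) : 0 <= enorm v.
Proof. exact: sqrtr_ge0. Qed.

Lemma le_sqr (R : realType) (a b : R) : 0 <= b -> a ^+ 2 <= b ^+ 2 -> a <= b.
Proof.
move=> b0 ab; apply: le_trans (ler_norm _) _.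
by rewrite -(@ler_pXn2r _ 2)// ?nnegrE// -normrX ger0_norm// sqr_ge0.
Qed.

(** Cauchy-Schwarz against the all-ones vector, read off from the nonnegative sum of squared
    deviations from the mean, scaled by n to avoid division. *)
Lemma sum_sqr_le (R : realType) (n : nat) (a : 'I_n -> R) :
  (\sum_i a i) ^+ 2 <= n%:R * \sum_i a i ^+ 2.
Proof.
case: n a => [|n] a; first by rewrite !big_ord0 mulr0 expr0n.
set A := \sum_i a i; set S := \sum_i _; set N : R := n.+1%:R.
have N0 : 0 < N by rewrite ltr0n.
have : 0 <= \sum_i (N * a i - A) ^+ 2 by apply: sumr_ge0 => i _; exact: sqr_ge0.
have -> : \sum_i (N * a i - A) ^+ 2 = N * (N * S - A ^+ 2).
  under eq_bigr do rewrite sqrrB.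
  rewrite big_split/= sumrB sumr_const card_ord -[_ *+ n.+1]mulr_natl -/N.
  under eq_bigr do rewrite exprMn.
  rewrite -mulr_sumr -/S.
  have -> : \sum_i (N * a i * A) *+ 2 = 2 * N * A * A.
    by rewrite mulr_sumr; apply: eq_bigr => i _; rewrite mulr2n; ring.
  by ring.
by rewrite pmulr_rge0// subr_ge0.
Qed.

(** The weight b = q^(-1/2) exactly cancels the factor sqrt q that Cauchy-Schwarz loses between the
    two norms. *)
Lemma sum_norm_le_enorm (R : realType) (q : nat) (P : pred 'I_q) (v : 'rV[R]_q) :
  (0 < q)%N -> hard_beta R q * \sum_(i | P i) `|v 0 i| <= enorm v.
Proof.
move=> q0; have b0 := hard_beta_gt0 R q0.
apply: le_sqr; first exact: enorm_ge0.
rewrite enorm_sqr exprMn.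
have le1 : (\sum_(i | P i) `|v 0 i|) ^+ 2 <= q%:R * \sum_i v 0 i ^+ 2.
  apply: (@le_trans _ _ ((\sum_i `|v 0 i|) ^+ 2)).
    rewrite ler_pXn2r ?nnegrE ?sumr_ge0// [leRHS](bigID P)/= lerDl.
    exact: sumr_ge0.
  apply: le_trans (sum_sqr_le _) _.
  by under eq_bigr do rewrite real_normK ?num_real//.
apply: le_trans (ler_wpM2l (sqr_ge0 _) le1) _.
by rewrite mulrA [_ * q%:R]mulrC hard_beta_sqr// mul1r.
Qed.

Lemma psi_sum_bound (R : realType) (q : nat) (y : 'rV[R]_q) : (0 < q)%N ->
  `|psi_sum y| <= psi_const R.
Proof.
move=> q0; apply: le_trans (ler_norm_sum _ _ _) _.
apply: (@le_trans _ _ (\sum_(i < q) psi_const R * hard_beta R q ^+ 2)).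
  rewrite [leRHS](bigID (fun i : 'I_q => (q./2 <= i)%N))/= -[leLHS]addr0.
  apply: lerD.
    by apply: ler_sum => i _; exact/psi_bound/hard_beta_gt0.
  by apply: sumr_ge0 => i _; rewrite mulr_ge0 ?sqr_ge0// ltW// psi_const_gt0.
by rewrite sumr_const card_ord -mulrnAr -mulr_natl hard_beta_sqr// mulr1.
Qed.

Lemma psi_sum_lipschitz (R : realType) (q : nat) (y z : 'rV[R]_q) : (0 < q)%N ->
  `|psi_sum y - psi_sum z| <= psi_const R * enorm (y - z).
Proof.
move=> q0; rewrite /psi_sum -sumrB.
apply: le_trans (ler_norm_sum _ _ _) _.
have /(ler_wpM2l (ltW (psi_const_gt0 R))) := sum_norm_le_enorm
  (fun i : 'I_q => (q./2 <= i)%N) (y - z) q0.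
apply: le_trans; rewrite mulrA mulr_sumr; apply: ler_sum => i _.
by rewrite !mxE; exact/psi_lipschitz/hard_beta_gt0.
Qed.

(** The sublevel set enters only through (x + 1)^2 <= 1, which bounds the prefactor of f by 2. *)
Lemma hard_f_lipschitz_in_y (R : realType) (q : nat) (X : set 'rV[R]_1) :
  (0 < q)%N -> (forall x, X x -> (x 0 0 + 1) ^+ 2 <= 1) ->
  lipschitz_in_y_on (2 * psi_const R) X (@hard_f R q).
Proof.
move=> q0 HX x /HX x1 y z; rewrite !hard_fE -mulrBr normrM ger0_norm; last first.
  by rewrite mulr_ge0// sqr_ge0.
have := psi_sum_lipschitz y z q0; have := enorm_ge0 (y - z) => e0 h.
apply: (@le_trans _ _ (2 * `|psi_sum y - psi_sum z|)); last by lra.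
by rewrite ler_wpM2r//; lra.
Qed.

Lemma enorm_le_scale (R : realType) (m n : nat) (L : R) (u : 'rV[R]_m) (v : 'rV[R]_n) :
  0 <= L -> \sum_j u 0 j ^+ 2 <= L ^+ 2 * \sum_j v 0 j ^+ 2 ->
  enorm u <= L * enorm v.
Proof.
move=> L0 h; apply: le_sqr; first by rewrite mulr_ge0// enorm_ge0.
by rewrite exprMn !enorm_sqr.
Qed.

Lemma sqr_le_norm (R : realType) (a b : R) : `|a| <= b -> a ^+ 2 <= b ^+ 2.
Proof.
move=> ab; rewrite -[a ^+ 2]ger0_norm ?sqr_ge0// normrX ler_pXn2r// nnegrE//.
exact: le_trans ab.
Qed.

Lemma sqrD_le (R : realType) (a b : R) : (a + b) ^+ 2 <= 2 * (a ^+ 2 + b ^+ 2).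
Proof. by have := sqr_ge0 (a - b); lra. Qed.

(** Bounds the x-component of the gradient: a and a' stand for x + 1 at the two points, S and S' for
    [psi_sum], N for the distance of the y-parts. The difference of products is split as (a - a')S +
    a'(S - S'). *)
Lemma hard_f_grad_l_le (R : realType) (C a a' S S' N : R) :
  0 <= C -> `|a'| <= 1 -> `|S| <= C -> `|S - S'| <= C * N ->
  (4 * a * S - 4 * a' * S') ^+ 2 <= 32 * C ^+ 2 * ((a - a') ^+ 2 + N ^+ 2).
Proof.
move=> C0 a1 SC SN.
have h : `|4 * a * S - 4 * a' * S'| <= 4 * C * (`|a - a'| + N).
  have -> : 4 * a * S - 4 * a' * S' = 4 * ((a - a') * S + a' * (S - S')) by ring.
  rewrite normrM (ger0_norm (_ : 0 <= 4))// -mulrA ler_wpM2l//.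
  rewrite (le_trans (ler_normD _ _))// !normrM mulrDr lerD//.
    by rewrite mulrC ler_wpM2r.
  by rewrite (le_trans _ SN)// ler_piMl.
apply: le_trans (sqr_le_norm h) _; rewrite exprMn.
have := sqrD_le `|a - a'| N; rewrite real_normK ?num_real// => h2.
apply: le_trans (ler_wpM2l (sqr_ge0 _) h2) _.
by rewrite exprMn; lra.
Qed.

(** Bounds one y-component: D and D' stand for values of [dpsi], d for the difference of that
    coordinate. Keeping b^2 in front of (a - a')^2 is essential, because this term recurs in each of
    up to q components. *)
Lemma hard_f_grad_r_le (R : realType) (C b a a' D D' d : R) :
  0 <= C -> `|a| <= 1 -> `|a'| <= 1 -> `|D| <= C * b -> `|D - D'| <= C * `|d| ->
  (2 * a ^+ 2 * D - 2 * a' ^+ 2 * D') ^+ 2 <=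
    32 * C ^+ 2 * (b ^+ 2 * (a - a') ^+ 2 + d ^+ 2).
Proof.
move=> C0 a1 a'1 DC Dd.
have h : `|2 * a ^+ 2 * D - 2 * a' ^+ 2 * D'| <= 2 * C * (2 * (b * `|a - a'|) + `|d|).
  have -> : 2 * a ^+ 2 * D - 2 * a' ^+ 2 * D' =
    2 * ((a + a') * (D * (a - a')) + a' ^+ 2 * (D - D')) by ring.
  rewrite normrM (ger0_norm (_ : 0 <= 2))// -mulrA ler_wpM2l//.
  rewrite (le_trans (ler_normD _ _))// [leRHS]mulrDr lerD//.
    rewrite 2!normrM [leRHS]mulrCA; apply: ler_pM => //.
      by rewrite (le_trans (ler_normD _ _))//; lra.
    by rewrite mulrA ler_wpM2r.
  rewrite normrM (le_trans _ Dd)// ler_piMl// normrX expr_le1//.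
apply: le_trans (sqr_le_norm h) _; rewrite exprMn.
have := sqrD_le (2 * (b * `|a - a'|)) `|d|.
rewrite !exprMn !real_normK ?num_real// => h2.
apply: (le_trans (ler_wpM2l _ h2)); first by rewrite mulr_ge0// sqr_ge0.
have := mulr_ge0 (sqr_ge0 C) (sqr_ge0 d); lra.
Qed.

Lemma hard_f_lipschitz_gradients (R : realType) (q : nat) (X : set 'rV[R]_1) :
  (0 < q)%N -> (forall x, X x -> (x 0 0 + 1) ^+ 2 <= 1) ->
  lipschitz_gradients_on (8 * psi_const R) [set z : 'rV[R]_(1 + q) | X (lsubmx z)]
    (joint (@hard_f R q)).
Proof.
move=> q0 HX; split=> [z _|z w /HX z1 /HX w1].
  by have d := is_diff_joint_hard_f z q0; exact: ex_diff.
have b0 := hard_beta_gt0 R q0.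
have abs1 (a : R) : a ^+ 2 <= 1 -> `|a| <= 1.
  by rewrite -[a ^+ 2]ger0_norm ?sqr_ge0// normrX expr_le1.
apply: enorm_le_scale; first by rewrite mulr_ge0// ltW// psi_const_gt0.
rewrite !big_split_ord !big_ord1 /=.
set a := lsubmx z 0 0 + 1; set a' := lsubmx w 0 0 + 1.
have e1 : (z - w) 0 (lshift q 0) = a - a'.
  by rewrite /a /a' !mxE; ring.
have e2 i : (z - w) 0 (rshift 1 i) = (rsubmx z - rsubmx w) 0 i by rewrite !mxE.
have eg i : (grad (joint (@hard_f R q)) z - grad (joint (@hard_f R q)) w) 0 i =
  grad (joint (@hard_f R q)) z 0 i - grad (joint (@hard_f R q)) w 0 i.
  by rewrite [LHS]mxE [X in _ + X]mxE.
rewrite eg !grad_joint_hard_f_l// -/a -/a' e1.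
under [X in _ <= _ * (_ + X)]eq_bigr do rewrite e2.
rewrite -enorm_sqr.
have C0 := ltW (psi_const_gt0 R).
have Hl := @hard_f_grad_l_le _ _ a _ _ _ _ C0 (abs1 _ w1) (psi_sum_bound (rsubmx z) q0)
  (psi_sum_lipschitz (rsubmx z) (rsubmx w) q0).
rewrite -/a' in Hl.
have Hr : \sum_(i < q) (grad (joint (@hard_f R q)) z - grad (joint (@hard_f R q)) w)
    0 (rshift 1 i) ^+ 2 <=
    32 * psi_const R ^+ 2 * ((a - a') ^+ 2 + enorm (rsubmx z - rsubmx w) ^+ 2).
  (* Components in the first half vanish, so the bound may be summed over all q indices; then q b^2
     = 1 absorbs the repeated x-term. *)
  apply: (@le_trans _ _ (\sum_(i < q) 32 * psi_const R ^+ 2 *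
    (hard_beta R q ^+ 2 * (a - a') ^+ 2 + (rsubmx z - rsubmx w) 0 i ^+ 2))).
    apply: ler_sum => i _; rewrite eg !grad_joint_hard_f_r//; case: ifPn => _.
      apply: hard_f_grad_r_le => //; [exact: abs1|exact: abs1|exact: dpsi_bound|].
      have -> : (rsubmx z - rsubmx w) 0 i = rsubmx z 0 i - rsubmx w 0 i by rewrite !mxE.
      exact: dpsi_lipschitz.
    rewrite subr0 expr0n/= mulr_ge0//; first by rewrite mulr_ge0// sqr_ge0.
    by rewrite addr_ge0 ?sqr_ge0// mulr_ge0// sqr_ge0.
  rewrite -mulr_sumr big_split/= sumr_const card_ord -enorm_sqr.
  by rewrite -[_ *+ q]mulr_natl [q%:R * _]mulrA hard_beta_sqr// mul1r.
(* The x-part and the y-part contribute 32 each, and 32 + 32 = 8^2. *)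
have e (s u v : R) : s <= 32 * psi_const R ^+ 2 * u -> v <= 32 * psi_const R ^+ 2 * u ->
    s + v <= (8 * psi_const R) ^+ 2 * u.
  rewrite exprMn; lra.
exact: e Hl Hr.
Qed.

(** * Smoothness, strict convexity and minimizer of g *)

Lemma sum_sqr_diff_le (R : realType) (n : nat) (a : nat -> R) :
  \sum_(k < n) (a k.+1 - a k) ^+ 2 <= 4 * \sum_(k < n.+1) a k ^+ 2.
Proof.
have h1 : \sum_(k < n) a k.+1 ^+ 2 <= \sum_(k < n.+1) a k ^+ 2.
  by rewrite big_ord_recl lerDr sqr_ge0.
have h2 : \sum_(k < n) a k ^+ 2 <= \sum_(k < n.+1) a k ^+ 2.
  by rewrite big_ord_recr lerDl sqr_ge0.
apply: (@le_trans _ _ (2 * (\sum_(k < n) a k.+1 ^+ 2 + \sum_(k < n) a k ^+ 2))).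
  rewrite -big_split/= mulr_sumr; apply: ler_sum => k _.
  by rewrite -[a k ^+ 2]sqrrN sqrD_le.
by lra.
Qed.

Lemma sum_sqr_rvcoord (R : realType) (q : nat) (v : 'rV[R]_q) :
  \sum_(k < q.+1) rvcoord v k ^+ 2 = \sum_(i < q) v 0 i ^+ 2.
Proof.
rewrite big_ord_recl rvcoord_default// expr0n add0r.
by apply: eq_bigr => i _; rewrite rvcoordS.
Qed.

Lemma chainB (R : realType) (q : nat) (y z : 'rV[R]_q) (k : nat) :
  chain y k - chain z k =
  if (k < q)%N then rvcoord (y - z) k.+1 - rvcoord (y - z) k else 0.
Proof. by rewrite /chain; case: ifP => _; rewrite ?rvcoordB; ring. Qed.

(** The gradient is 1/4 of a difference of residuals, which are themselves differences of
    coordinates up to a constant. Each differencing costs at most a factor 4 in squared norm, and 4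
    * 4 / 16 = 1. *)
Lemma hard_g_lipschitz_gradients (R : realType) (q : nat) : (0 < q)%N ->
  lipschitz_gradients_on 1 setT (@hard_g R q).
Proof.
move=> q0; split=> [z _|z w _ _].
  by have d := is_diff_hard_g z q0; exact: ex_diff.
apply: enorm_le_scale => //; rewrite expr1n mul1r.
pose d k := chain z k - chain w k.
have e (k : 'I_q) : (grad (@hard_g R q) z - grad (@hard_g R q) w) 0 k ^+ 2 =
    1 / 16 * (d k.+1 - d k) ^+ 2.
  rewrite [X in X ^+ 2]mxE [X in _ + X]mxE !grad_hard_g// /d.
  by field.
under eq_bigr do rewrite e.
rewrite -mulr_sumr.
have h1 := sum_sqr_diff_le q d.
have h2 := sum_sqr_diff_le q (rvcoord (z - w)).
(* The additional term [d q] is 0 by the default value of [chain], so the output of one differencing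
   is the input of the other. *)
have h3 : \sum_(k < q.+1) d k ^+ 2 =
    \sum_(k < q) (rvcoord (z - w) k.+1 - rvcoord (z - w) k) ^+ 2.
  rewrite big_ord_recr/= {2}/d chainB ltnn expr0n addr0.
  by apply: eq_bigr => k _; rewrite /d chainB ltn_ord.
rewrite sum_sqr_rvcoord -h3 in h2; lra.
Qed.

(** The difference y - z has coordinate 0 at the default index 0, and equal residuals carry this
    zero from each coordinate to the next. *)
Lemma chain_inj (R : realType) (q : nat) (y z : 'rV[R]_q) :
  (forall j, (j < q)%N -> chain y j = chain z j) -> y = z.
Proof.
move=> H; have e j : (j <= q)%N -> rvcoord (y - z) j = 0.
  elim: j => [|j IH] jq; first by rewrite rvcoord_default.
  have := chainB y z j; rewrite H// subrr jq IH ?(ltnW jq)// subr0.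
  by move=> <-.
apply/rowP => i; apply/eqP; rewrite -subr_eq0; apply/eqP.
by rewrite -[RHS](e i.+1)// rvcoordS !mxE.
Qed.

Lemma hard_g_strictly_convex (R : realType) (q : nat) : (0 < q)%N ->
  strictly_convex (@hard_g R q).
Proof.
move=> q0 y z t yz t0 t1; rewrite !hard_gE//.
(* Residuals are affine in y, so the convexity gap is an exact sum of squares; it is zero only if y
   and z have equal residuals. *)
have e : t * (1 / 8 * \sum_(j < q) chain y j ^+ 2) +
    (1 - t) * (1 / 8 * \sum_(j < q) chain z j ^+ 2) =
    1 / 8 * \sum_(j < q) chain (t *: y + (1 - t) *: z) j ^+ 2 +
    t * (1 - t) / 8 * \sum_(j < q) (chain y j - chain z j) ^+ 2.
  rewrite !mulr_sumr -!big_split/=; apply: eq_bigr => j _.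
  by rewrite /chain ltn_ord !rvcoord_linear; field.
rewrite e ltrDl mulr_gt0//; first by rewrite divr_gt0// mulr_gt0// subr_gt0.
rewrite lt0r sumr_ge0 ?andbT; last by move=> j _; exact: sqr_ge0.
apply: contra yz => /eqP s0; apply/eqP/chain_inj => j jq.
have := psumr_eq0P _ s0; move=> /(_ (fun i _ => sqr_ge0 _) (Ordinal jq) isT).
by move/eqP; rewrite sqrf_eq0 subr_eq0 => /eqP.
Qed.

Lemma hard_g_quadratic (R : realType) (q : nat) : (0 < q)%N ->
  is_quadratic (@hard_g R q).
Proof.
move=> q0.
(* The row of residuals is yD - e, with D bidiagonal and e carrying b in its first entry; the
   quadratic form comes from expanding its squared norm. *)
pose D : 'M[R]_q := \matrix_(i, j) ((i == j :> nat)%:R - (i.+1 == j :> nat)%:R).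
pose e : 'rV[R]_q := \row_j ((j == 0%N :> nat)%:R * hard_beta R q).
exists (1 / 8 *: (D *m D^T)), (- (1 / 4) *: (e *m D^T)), (1 / 8 * (e *m e^T) 0 0).
move=> y.
have Dy : \row_j chain y j = y *m D - e.
  apply/rowP => j; rewrite !mxE /chain ltn_ord; congr (_ - _).
  rewrite /rvcoord big_mkcond [X in _ - X]big_mkcond/= -sumrB.
  apply: eq_bigr => i _; rewrite mxE mulrBr eqSS.
  by do 2!case: (_ == _ :> nat); rewrite ?mulr1 ?mulr0.
rewrite hard_gE//.
have subE (u v : 'rV[R]_q) j : (u - v) 0 j = u 0 j - v 0 j by rewrite !mxE.
have -> : \sum_(j < q) chain y j ^+ 2 = ((y *m D) *m (y *m D)^T) 0 0
    - 2 * (e *m (y *m D)^T) 0 0 + (e *m e^T) 0 0.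
  rewrite 3![(_ *m _^T) 0 0]mxE mulr_sumr -sumrB -big_split/=.
  apply: eq_bigr => j _.
  have -> : chain y j = (\row_i chain y i) 0 j by rewrite mxE.
  by rewrite Dy subE ![_^T _ _]mxE; ring.
have scale11 (c : R) (A : 'M[R]_1) : (c *: A) 0 0 = c * A 0 0 by rewrite mxE.
rewrite trmx_mul !mulmxA -scalemxAr -!scalemxAl !scale11 !mulmxA.
by field.
Qed.

(** The constant vector has zero residuals, so the minimum of g is 0; any minimizer then has zero
    residuals too, and these determine it. *)
Lemma hard_g_argmin (R : realType) (q : nat) : (0 < q)%N ->
  argmin (@hard_g R q) = [set const_mx (hard_beta R q)].
Proof.
move=> q0.
have c0 j : chain (const_mx (hard_beta R q) : 'rV[R]_q) j = 0.
  rewrite /chain; case: ltnP => // jq.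
  rewrite -[j.+1]/(Ordinal jq).+1 rvcoordS mxE.
  case: j jq => [|j] jq; first by rewrite rvcoord_default// eqxx mul1r; ring.
  by rewrite -[X in rvcoord _ X]/(Ordinal (ltnW jq)).+1 rvcoordS mxE mul0r; ring.
have g0 : hard_g (const_mx (hard_beta R q) : 'rV[R]_q) = 0.
  by rewrite hard_gE// big1 ?mulr0// => j _; rewrite c0 expr0n.
apply/seteqP; split=> [y /(_ (const_mx (hard_beta R q)))|_ -> z].
  rewrite g0 hard_gE// => gy; apply: chain_inj => j jq; rewrite c0.
  have s_ge0 : 0 <= \sum_(j < q) chain y j ^+ 2.
    by apply: sumr_ge0 => i _; exact: sqr_ge0.
  have s0 : \sum_(j < q) chain y j ^+ 2 = 0 by lra.
  have := psumr_eq0P _ s0; move=> /(_ (fun i _ => sqr_ge0 _) (Ordinal jq) isT).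
  by move/eqP; rewrite sqrf_eq0 => /eqP.
by rewrite g0 hard_gE// mulr_ge0// sumr_ge0// => j _; exact: sqr_ge0.
Qed.

(** * The value function *)

(** At b the penalty is still on its quadratic branch, with value b^2/2. The m = q/2 equal terms add
    up to q b^2/4 = 1/4. *)
Lemma hard_f_const (R : realType) (q m : nat) (x : 'rV[R]_1) : (0 < m)%N -> q = m.*2 ->
  hard_f x (const_mx (hard_beta R q) : 'rV[R]_q) = (x 0 0 + 1) ^+ 2 / 2.
Proof.
move=> m0 ->; have q0 : (0 < m.*2)%N by rewrite double_gt0.
have b0 := hard_beta_gt0 R q0; have b1 := hard_beta_sqr R q0.
rewrite hard_fE /psi_sum doubleK.
under eq_bigr do rewrite mxE (psi_self b0).
rewrite -(big_geq_mkord m m.*2 xpredT (fun=> hard_beta R m.*2 ^+ 2 / 2)).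
rewrite sumr_const_nat -addnn addnK addnn -[_ *+ m]mulr_natl.
have -> : 2 * (x 0 0 + 1) ^+ 2 * (m%:R * (hard_beta R m.*2 ^+ 2 / 2)) =
  (x 0 0 + 1) ^+ 2 / 2 * (2 * m%:R * hard_beta R m.*2 ^+ 2) by field.
by rewrite -natrM mul2n b1 mulr1.
Qed.

Lemma bilevel_valueE (R : realType) (dx dy : nat) (f : 'rV[R]_dx -> 'rV[R]_dy -> R)
    (g : 'rV[R]_dy -> R) (y0 : 'rV[R]_dy) (x : 'rV[R]_dx) :
  argmin g = [set y0] ->
  bilevel_value f g x = f x y0 /\
  is_minimum [set f x y | y in argmin g] (bilevel_value f g x).
Proof.
move=> gy0; rewrite /bilevel_value gy0 image_set1 inf1; split=> //.
by split=> // _ ->.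
Qed.

(** * Supports along a zero-respecting run *)

Definition vanishes_from (R : realType) (n m : nat) (v : 'rV[R]_n) : Prop :=
  forall i : 'I_n, (m <= i)%N -> v 0 i = 0.

Lemma vanishes_from_supp (R : realType) (n m : nat) (v : 'rV[R]_n) (A : {set 'I_n}) :
  supp v \subset A -> (forall i, i \in A -> (i < m)%N) -> vanishes_from m v.
Proof.
move=> /fintype.subsetP vA Am i mi; apply/eqP/negPn/negP => vi.
by have := Am i (vA i _); rewrite inE vi ltnNge mi => /(_ isT).
Qed.

Lemma supp_vanishes_from (R : realType) (n m : nat) (v : 'rV[R]_n) (i : 'I_n) :
  vanishes_from m v -> i \in supp v -> (i < m)%N.
Proof. by move=> vm; rewrite inE ltnNge; apply: contra => /vm ->. Qed.

Lemma vanishes_from_le (R : realType) (n m m' : nat) (v : 'rV[R]_n) :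
  (m <= m')%N -> vanishes_from m v -> vanishes_from m' v.
Proof. by move=> mm' vm i m'i; apply: vm; exact: leq_trans m'i. Qed.

(** f is separable in y and [dpsi b 0] is 0, so a zero coordinate has a zero partial derivative. *)
Lemma grad_y_hard_f_vanishes (R : realType) (q m : nat) (x : 'rV[R]_1) (y : 'rV[R]_q) :
  (0 < q)%N -> vanishes_from m y -> vanishes_from m (grad_y (@hard_f R q) x y).
Proof. by move=> q0 ym i mi; rewrite grad_y_hard_f// ym// dpsi0 mulr0 if_same. Qed.

(** Component i involves only residuals i and i + 1. For i > m these see only zero coordinates, and
    the offset b sits in residual 0 alone. *)
Lemma grad_hard_g_vanishes (R : realType) (q m : nat) (y : 'rV[R]_q) :
  (0 < q)%N -> vanishes_from m y -> vanishes_from m.+1 (grad (@hard_g R q) y).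
Proof.
move=> q0 ym i mi; rewrite grad_hard_g//.
have r0 j : (m < j)%N -> rvcoord y j = 0.
  case: j => // j mj; have [qj|jq] := leqP q j.
    by rewrite rvcoord_default// ltnS qj orbT.
  by rewrite -[j.+1]/(Ordinal jq).+1 rvcoordS ym.
have c0 j : (m < j)%N -> chain y j = 0.
  move=> mj; rewrite /chain; case: ifP => // _.
  by rewrite !r0 ?(leqW mj)// (gtn_eqF (leq_ltn_trans (leq0n m) mj)) mul0r !subr0.
by rewrite !c0 ?(leq_trans mi)// subrr mulr0.
Qed.

Lemma psi_sum_vanishes (R : realType) (q m : nat) (y : 'rV[R]_q) :
  (0 < q)%N -> (m <= q./2)%N -> vanishes_from m y -> psi_sum y = 0.
Proof.
move=> q0 mq ym; rewrite /psi_sum big1// => i qi.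
by rewrite ym ?psi0// ?hard_beta_gt0// (leq_trans mq).
Qed.

Lemma zero_respecting_vanishes (R : realType) (q T K : nat) (x : nat -> 'rV[R]_1)
    (y : nat -> nat -> 'rV[R]_q) :
  (0 < q)%N -> zero_respecting T K (@hard_f R q) (@hard_g R q) x y ->
  forall t k, (t < T)%N -> (k <= K)%N -> vanishes_from (t * K + k) (y t k).
Proof.
move=> q0 zr; elim/ltn_ind => t IHt; elim/ltn_ind => -[|k] IHk tT kK.
  apply: vanishes_from_supp (zr_outer zr tT) _ => i /bigcupP[s _ /bigcupP[k _]].
  move=> /supp_vanishes_from; apply.
  have st : (s < t)%N by [].
  have kK' : (k <= K)%N by rewrite -ltnS.
  apply: vanishes_from_le (IHt s st k (ltn_trans st tT) kK').
  (* An earlier outer iteration s < t has revealed at most sK + K = (s + 1)K <= tK coordinates. *)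
  rewrite addn0; apply: (@leq_trans (s * K + K)); first by rewrite leq_add2l.
  by rewrite -mulSnr leq_mul2r st orbT.
apply: vanishes_from_supp (zr_inner zr tT kK) _ => i /bigcupP[j _].
have jk : (j < k.+1)%N by [].
have yj := IHk j jk tT (ltnW (leq_trans jk kK)).
have le_jk : (t * K + j <= t * K + k)%N by rewrite leq_add2l -ltnS.
have yk := vanishes_from_le le_jk yj.
rewrite addnS; case/setUP => /supp_vanishes_from; apply.
  exact/(vanishes_from_le (leqnSn _))/grad_y_hard_f_vanishes.
exact: grad_hard_g_vanishes.
Qed.

(** Each y_s^K is supported in the first (s + 1)K <= TK <= q/2 coordinates, where f does not look.
    The factor [psi_sum] of the x-gradient is then 0 whatever x_s is, so the union of supports
    allowed for the next x is empty. *)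
Lemma zero_respecting_stuck (R : realType) (q T K : nat) (x : nat -> 'rV[R]_1)
    (y : nat -> nat -> 'rV[R]_q) :
  (0 < q)%N -> (T * K <= q./2)%N ->
  zero_respecting T K (@hard_f R q) (@hard_g R q) x y ->
  forall t, (t <= T)%N -> x t = 0.
Proof.
move=> q0 TKq zr [|t] tT; first exact: zr_x0 zr.
suff h : vanishes_from 0 (x t.+1) by apply/rowP => i; rewrite h// mxE.
apply: vanishes_from_supp (zr_x zr tT) _ => i /bigcupP[s _].
have sT : (s < T)%N by exact: leq_ltn_trans (leq_ord s) tT.
rewrite inE [i]ord1 grad_x_hard_f.
rewrite (psi_sum_vanishes q0 _ (zero_respecting_vanishes q0 zr sT (leqnn K))).
  by rewrite mulr0 eqxx.
by rewrite -mulSnr (leq_trans _ TKq)// leq_mul2r sT orbT.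
Qed.

Theorem theorem3p2 (R : realType) :
  exists c1 c2 : R, 0 < c1 /\ 0 < c2 /\
  forall T K : nat, (0 < T)%N -> (0 < K)%N ->
  let q := (2 * T * K)%N in
  let f : 'rV[R]_1 -> 'rV[R]_q -> R := @hard_f R q in
  let g : 'rV[R]_q -> R := @hard_g R q in
  let phi : 'rV[R]_1 -> R := bilevel_value f g in
  let X : set 'rV[R]_1 := [set x | phi x <= phi 0] in
  (psi (hard_beta R q) 0 = 0 /\
   is_derive (0 : R) (1 : R) (psi (hard_beta R q)) 0) /\
  lipschitz_in_y_on c1 X f /\
  lipschitz_gradients_on c2 [set z : 'rV[R]_(1 + q) | X (lsubmx z)] (joint f) /\
  (is_quadratic g /\ strictly_convex g /\ lipschitz_gradients_on 1 setT g) /\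
  (forall x : 'rV[R]_1,
     is_minimum [set f x y | y in argmin g] (phi x) /\
     phi x = (x 0 0 + 1) ^+ 2 / 2) /\
  (forall (x : nat -> 'rV[R]_1) (y : nat -> nat -> 'rV[R]_q),
     zero_respecting T K f g x y ->
     forall t : nat, (t <= T)%N -> x t = 0).
Proof.
have C0 := psi_const_gt0 R.
exists (2 * psi_const R), (8 * psi_const R).
split; first by rewrite mulr_gt0.
split; first by rewrite mulr_gt0.
move=> T K T0 K0 q f g phi X.
have TK0 : (0 < T * K)%N by rewrite muln_gt0 T0.
have q2 : q = (T * K).*2 by rewrite /q -mulnA mul2n.
have q0 : (0 < q)%N by rewrite q2 double_gt0.
have phiE x : is_minimum [set f x y | y in argmin g] (phi x) /\
    phi x = (x 0 0 + 1) ^+ 2 / 2.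
  have [e ?] := bilevel_valueE f x (hard_g_argmin R q0); split=> //.
  by rewrite /phi e; exact: hard_f_const q2.
(* As phi(0) = 1/2, the sublevel set is given by (x + 1)^2 <= 1. *)
have X1 x : X x -> (x 0 0 + 1) ^+ 2 <= 1.
  by rewrite /X /mkset (phiE x).2 (phiE 0).2 mxE; lra.
split.
  split; first exact/psi0/hard_beta_gt0.
  by have := is_derive_psi 0 (hard_beta_gt0 R q0); rewrite dpsi0.
split; first exact: hard_f_lipschitz_in_y.
split; first exact: hard_f_lipschitz_gradients.
split.
  split; first exact: hard_g_quadratic.
  by split; [exact: hard_g_strictly_convex|exact: hard_g_lipschitz_gradients].
split=> // x y; apply: zero_respecting_stuck => //.
by rewrite q2 doubleK.
Qed.
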